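(* Let $r$ be a positive integer and let $n$ be sufficiently large. Let $K=K_r(n_1,\dots,n_r)$ be an $n$-vertex complete $r$-partite graph with parts $V_1,\dots,V_r$, $|V_i|=n_i$, $n_1\ge n_2\ge\cdots\ge n_r$, and let $G$ be a graph obtained from $K$ by adding $\alpha_1$ class-edges and deleting $\alpha_2$ cross-edges, where $\max\{\alpha_1,\alpha_2\}\le \frac{n}{(10r)^3}$. (i) If $n_1-n_r\le \frac{n}{100}$, then, writing $\phi:=\max\{n_1-n_r,\,2(\alpha_1+\alpha_2)\}$, \[\left|\lambda(G)-\lambda(K)-\frac{2(\alpha_1-\alpha_2)}{n}\right|\le \frac{56(\alpha_1+\alpha_2)\phi}{n^2}.\] (ii) If $n_1-n_r\ge 2k$ for an integer $k\le \frac{n}{(10r)^3}$, then, writing $\psi:=\max\{3k,\,2(\alpha_1+\alpha_2)\}$, \[\lambda(G)\le \lambda(T_{n,r})+\frac{2(\alpha_1-\alpha_2)}{n}-\frac{2(r-1)k^2}{rn}\Big(1-\frac{28r\psi}{n}\Big)^4+\frac{56(\alpha_1+\alpha_2)\cdot 7r\psi}{n^2}.\]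
   Context: $\lambda(G)$ is the spectral radius of the adjacency matrix of $G$. $K_r(n_1,\dots,n_r)$ is the complete $r$-partite graph with parts of sizes $n_1,\dots,n_r$, and $T_{n,r}$ is the $n$-vertex complete $r$-partite graph with part sizes as equal as possible. Given the vertex partition $V_1\cup\dots\cup V_r$, an edge is a class-edge if both its ends lie in the same $V_i$, and a cross-edge otherwise. ''Adding $\alpha_1$ class-edges'' means adding $\alpha_1$ new edges each inside some $V_i$; ''deleting $\alpha_2$ cross-edges'' means removing $\alpha_2$ edges of $K$.
   Formalization: Proved for r ≥ 2 and integers k ≥ 0: for r = 1, both parts fail when G is a single edge (α1 = 1, α2 = 0, k = 0); for k = −1, part (ii) fails when G = K = T_{n,r}. *)

(* Defs.v *)
From HB Require Import structures.
From mathcomp Require Import all_boot all_order all_algebra.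
From mathcomp Require Import complex.
From mathcomp Require Import classical_sets reals.

Set Implicit Arguments.
Unset Strict Implicit.
Unset Printing Implicit Defensive.

Import Order.TTheory GRing.Theory Num.Theory.

Local Open Scope ring_scope.
Local Open Scope complex_scope.

Record sgraph (T : finType) := SGraph {
  adj : rel T;
  adj_sym : symmetric adj;
  adj_irrefl : irreflexive adj
}.

Definition edges (T : finType) (G : sgraph T) : {set {set T}} :=
  [set e : {set T} |
    [exists x, exists y, adj G x y && (e == [set x; y]%SET)]]%SET.

Definition adjmx (R : realType) (n : nat) (G : sgraph 'I_n) : 'M[R]_n :=
  \matrix_(i, j) (adj G i j)%:R.

(* Largest modulus of a complex eigenvalue. For 0 < n the set is finite and
   nonempty, so that the sup is attained. *)
Definition spectral_radius (R : realType) (n : nat) (A : 'M[R]_n) : R :=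
  sup [set x : R | exists2 z : R[i],
    eigenvalue (map_mx (real_complex R) A) z & `|z| = x%:C]%classic.

Definition lambda (R : realType) (n : nat) (G : sgraph 'I_n) : R :=
  spectral_radius (adjmx R G).

Section Multipartite.

Variables (T : finType) (C : eqType) (part : T -> C).

Definition cmp_rel : rel T := fun x y => part x != part y.

Lemma cmp_sym : symmetric cmp_rel.
Proof. by move=> x y; rewrite /cmp_rel eq_sym. Qed.

Lemma cmp_irrefl : irreflexive cmp_rel.
Proof. by move=> x; rewrite /cmp_rel eqxx. Qed.

(* [part x] is the index of the part containing the vertex [x]. *)
Definition complete_multipartite : sgraph T := SGraph cmp_sym cmp_irrefl.

Definition vpart (i : C) : {set T} := [set x | part x == i]%SET.

End Multipartite.

(* [ns] lists the part sizes; indices start at 0. *)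
Definition has_part_sizes (n r : nat) (part : 'I_n -> 'I_r)
    (ns : r.-tuple nat) : Prop :=
  forall i : 'I_r, #|vpart part i| = tnth ns i.

Definition turan_part (n r : nat) (x : 'I_n) : nat := (x %% r)%N.

(* For 0 < r the parts are the residue classes mod r; see turan_part_balanced. *)
Definition turan (n r : nat) : sgraph 'I_n :=
  complete_multipartite (@turan_part n r).

Lemma card_turan_part (n r i : nat) : (i < r)%N ->
  #|vpart (@turan_part n r) i| = (n %/ r + (i < n %% r))%N.
Proof.
move=> ir.
have r0 : (0 < r)%N by apply: leq_ltn_trans ir.
have -> : #|vpart (@turan_part n r) i| = (\sum_(x < n) (x %% r == i))%N.
  rewrite -sum1_card (eq_bigl (fun x : 'I_n => x %% r == i)%N).
    by rewrite big_mkcond; apply: eq_bigr => x _; case: eqP.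
  by move=> x; rewrite inE.
elim: n => [|n IHn]; first by rewrite big_ord0 div0n mod0n ltn0.
rewrite big_ord_recr /= {}IHn.
have nr : (n %% r < r)%N by rewrite ltn_mod.
rewrite divnS // modnS; case: ifPn => [rdvd|_] /=.
  have {}rdvd : (r %| (n %% r).+1)%N.
    by move: rdvd; rewrite {1}(divn_eq n r) -addnS dvdn_addr ?dvdn_mull.
  have rle : (r <= (n %% r).+1)%N by apply: dvdn_leq.
  have ile : (i <= n %% r)%N by rewrite -ltnS; apply: leq_trans ir rle.
  rewrite addn0 -addnA addnC; congr addn.
  by case: ltngtP ile.
by rewrite add0n -addnA ltnS; congr addn; case: ltngtP.
Qed.

Lemma turan_part_balanced (n r i j : nat) : (i < r)%N -> (j < r)%N ->
  (#|vpart (@turan_part n r) i| <= #|vpart (@turan_part n r) j| + 1)%N.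
Proof.
move=> ir jr; rewrite !card_turan_part // -addnA leq_add2l.
by apply: leq_trans (leq_b1 _) (leq_addl _ _).
Qed.

Definition class_pairs (T : finType) (C : finType) (part : T -> C) :
    {set {set T}} :=
  [set e : {set T} | (#|e| == 2) && [exists i, e \subset vpart part i]]%SET.

(* [G] arises from the complete multipartite graph [K] on [part] by adding the
   [a1] class-edges [A] and deleting the [a2] cross-edges [D]; every edge of
   [K] is a cross-edge and every class pair is a nonedge of [K]. *)
Definition modification (T : finType) (C : finType) (part : T -> C)
    (G : sgraph T) (a1 a2 : nat) : Prop :=
  let K := complete_multipartite part in
  exists A D : {set {set T}},
    [/\ A \subset class_pairs part, #|A| = a1,
        D \subset edges K, #|D| = a2 &
        edges G = ((edges K :\: D) :|: A)%SET].

(* Main.v *)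
Require Import Defs.
From mathcomp Require Import classical_sets reals.
From mathcomp Require Import all_boot all_order all_algebra.
From mathcomp Require Import complex.
From mathcomp Require Import ring lra.

(* Write E = A(G) - A(K).  In an eigenvector of G for lambda(G) with maximal
   entry 1, the entries on V_i differ from S / (lambda + n_i), S the sum of all
   entries, only through the at most 2 (alpha1 + alpha2) nonzero entries of E, so
   all entries are 1 - O(phi / n); the same holds for K.  Pairing the eigenvectors
   x of K and y of G gives (lambda(G) - lambda(K)) <x, y> = x^T E y, and here every
   nonzero entry of E contributes about 1 / n; this is (i).

   For (ii), lambda(K) is the positive root of sum_i n_i / (lambda + n_i) = 1.
   Comparing with the same equation for the balanced sizes, where q = floor (n / r),
   bounds lambda(T) - lambda(K) below by about (r - 1) / (r n) times
   sum_i (n_i - q) (n_i - q - 1), which is at least 2 k ^ 2.  If n_1 - n_r is at most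
   7 r psi this is combined with (i); if n_1 - n_r is larger, the gain of order
   (n_1 - n_r) ^ 2 / n dominates every error term. *)

Set Implicit Arguments.
Unset Strict Implicit.
Unset Printing Implicit Defensive.

Import Order.TTheory GRing.Theory Num.Theory.

Local Open Scope ring_scope.

(** * Spectral radius of a nonnegative symmetric matrix *)

Section SpectralRadius.
Variables (R : realType) (n : nat).
Local Notation toC := (real_complex R).

(** A unitary matrix diagonalizes [A] over the complex numbers with a real diagonal [d]; [rho] is
    its largest entry. In the coordinates [c] of [x] in the eigenbasis, the quadratic form is the
    sum of [d i * |c i| ^ 2] and the squared norm is the sum of [|c i| ^ 2]. *)
Lemma symmetric_top_eigenvalue (A : 'M[R]_n) : (0 < n)%N -> A^T = A ->
  exists2 rho : R, eigenvalue A rho &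
    forall x : 'I_n -> R,
      \sum_u \sum_v A u v * x u * x v <= rho * \sum_u x u ^+ 2.
Proof.
move=> n0 symA.
pose AC := map_mx toC A.
have AH : AC \is hermsymmx.
  apply: realsym_hermsym.
    rewrite is_hermitianmxE expr0 scale1r; apply/eqP/matrixP => i j.
    by rewrite !mxE -[in LHS]symA mxE.
  by apply/mxOverP => i j; rewrite mxE; apply/complex_realP; exists (A i j).
have /hermitian_normalmx/orthomx_spectralP := AH.
have := hermitian_spectral_diag_real AH.
have := spectral_unitarymx AC.
move: (spectralmx AC) (spectral_diag AC) => P d Pu /mxOverP dreal ACE.
have Pinv := spectral.invmx_unitary Pu.
have PU := unitarymx_unit Pu.
pose i0 : 'I_n := Ordinal n0.
pose m := [arg max_(i > i0) complex.Re (d 0 i)]%O.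
have dE i : d 0 i = toC (complex.Re (d 0 i)) by rewrite RRe_real.
have mmax i : complex.Re (d 0 i) <= complex.Re (d 0 m).
  by rewrite /m; case: Order.TotalTheory.arg_maxP => // j _; apply.
exists (complex.Re (d 0 m)).
  suff: eigenvalue AC (d 0 m) by rewrite dE eigenvalue_map.
  apply/eigenvalueP; exists (row m P).
    rewrite -row_mul ACE !mulmxA mulmxV // mul1mx row_mul row_diag_mx.
    by rewrite -scalemxAl -rowE.
  (* A zero row of [P] would contradict the diagonal entry 1 of [P * P^-1]. *)
  apply/eqP => r0; have /eqP := row_mul m P (invmx P).
  rewrite mulmxV // r0 mul0mx => /eqP/rowP/(_ m)/eqP.
  by rewrite !mxE eqxx oner_eq0.
move=> x.
pose xC : 'rV[R[i]]_n := \row_j toC (x j).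
have xreal : (map_mx Num.conj xC^T) = xC^T.
  apply/matrixP => i j; rewrite !mxE; apply/CrealP.
  by apply/complex_realP; exists (x i).
pose c := xC *m map_mx Num.conj P^T.
have cE : map_mx Num.conj c^T = P *m xC^T.
  rewrite trmx_mul map_mxM xreal; congr (_ *m _).
  by apply/matrixP => i j; rewrite !mxE; apply: conjCK.
have E1 : toC (\sum_u \sum_v A u v * x u * x v) = \sum_i d 0 i * `|c 0 i| ^+ 2.
  transitivity ((xC *m AC *m xC^T) 0 0).
    rewrite exchange_big raddf_sum mxE; apply: eq_bigr => v _.
    rewrite !mxE mulr_suml raddf_sum; apply: eq_bigr => u _.
    by rewrite !mxE -!rmorphM [x u * _]mulrC.
  rewrite ACE Pinv !mulmxA -/c -mulmxA -cE mul_mx_diag mxE.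
  by apply: eq_bigr => i _; rewrite !mxE normCK mulrCA -!mulrA.
have E2 : toC (\sum_u x u ^+ 2) = \sum_i `|c 0 i| ^+ 2.
  transitivity ((xC *m xC^T) 0 0).
    by rewrite mxE raddf_sum; apply: eq_bigr => u _; rewrite !mxE -rmorphM expr2.
  have -> : xC *m xC^T = c *m map_mx Num.conj c^T.
    rewrite cE mulmxA /c -Pinv -[xC *m _ *m P]mulmxA.
    by rewrite mulVmx // mulmx1.
  by rewrite mxE; apply: eq_bigr => i _; rewrite !mxE normCK.
rewrite -lecR rmorphM /= E1 E2 mulr_sumr; apply: ler_sum => i _.
by apply: ler_wpM2r; rewrite ?exprn_ge0 // dE lecR.
Qed.

(** For a complex eigenpair [(z, w)], the triangle inequality and [A >= 0] make the moduli of [w] a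
    real test vector whose Rayleigh quotient is at least [|z|]. Hence no eigenvalue exceeds the top
    eigenvalue [rho] in modulus, and the supremum is [rho]. *)
Lemma spectral_radius_nonneg_symmetric (A : 'M[R]_n) : (0 < n)%N -> A^T = A ->
  (forall u v, 0 <= A u v) ->
  eigenvalue A (spectral_radius A) /\
    forall x : 'I_n -> R,
      \sum_u \sum_v A u v * x u * x v <= spectral_radius A * \sum_u x u ^+ 2.
Proof.
move=> n0 symA A0.
have [rho rhoA ray] := symmetric_top_eigenvalue n0 symA.
have rho_bound (z : R[i]) (a : R) : eigenvalue (map_mx toC A) z ->
    `|z| = toC a -> a <= rho.
  move=> /eigenvalueP[w wE w0] za.
  pose x u := complex.Re `|w 0 u|.
  have xE u : toC (x u) = `|w 0 u| by rewrite RRe_real // normr_real.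
  have x0 u : 0 <= x u by rewrite -lecR xE normr_ge0.
  have xpos : 0 < \sum_u x u ^+ 2.
    have [u wu] : exists u, w 0 u != 0.
      apply/existsP; apply: contra_neqT w0; rewrite negb_exists.
      move=> /forallP w0; apply/rowP => u; rewrite mxE.
      by apply/eqP; have := w0 u; rewrite negbK.
    rewrite (bigD1 u) //= ltr_wpDr ?sumr_ge0 // => [v _|]; first exact: exprn_ge0.
    by rewrite exprn_gt0 // -ltcR xE normr_gt0.
  rewrite -(ler_pM2r xpos); apply: le_trans (ray x).
  rewrite exchange_big mulr_sumr; apply: ler_sum => v _.
  have zv : a * x v <= \sum_u A u v * x u.
    rewrite -lecR rmorphM /= xE -za -normrM.
    have /rowP/(_ v) := wE; rewrite !mxE => <-.
    rewrite raddf_sum /=; apply: le_trans (ler_norm_sum _ _ _) _.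
    apply: ler_sum => u _; rewrite mxE normrM rmorphM /= xE mulrC.
    by rewrite ler_wpM2r // ger0_norm // ler0c.
  rewrite expr2 mulrA.
  apply: le_trans (ler_wpM2r (x0 v) zv) _.
  by rewrite mulr_suml.
suff -> : spectral_radius A = rho by [].
(* The bound applied to [rho] itself reads [|rho| <= rho]. *)
have rho0 : 0 <= rho.
  have rC : eigenvalue (map_mx toC A) (toC rho) by rewrite eigenvalue_map.
  have nE : `|toC rho| = toC (complex.Re `|toC rho|).
    by rewrite RRe_real // normr_real.
  by apply: le_trans (rho_bound _ _ rC nE); rewrite -lecR -nE normr_ge0.
have memrho : [set x : R | exists2 z : R[i],
    eigenvalue (map_mx toC A) z & `|z| = x%:C%C]%classic rho.
  by exists rho%:C%C; rewrite ?eigenvalue_map // ger0_norm // lecR.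
have ubrho : ubound [set x : R | exists2 z : R[i],
    eigenvalue (map_mx toC A) z & `|z| = x%:C%C]%classic rho.
  by move=> x [z ev zx]; apply: rho_bound ev zx.
apply/eqP; rewrite eq_le; apply/andP; split.
  by apply: ge_sup => //; exists rho.
apply: ub_le_sup => //; by exists rho.
Qed.

End SpectralRadius.

Section GraphLambda.
Variables (R : realType) (n : nat) (G : sgraph 'I_n).
Hypothesis n0 : (0 < n)%N.

Let adj_tr : (adjmx R G)^T = adjmx R G.
Proof. by apply/matrixP => u v; rewrite !mxE adj_sym. Qed.

Let adj_ge0 u v : 0 <= adjmx R G u v.
Proof. by rewrite mxE ler0n. Qed.

Lemma lambda_rayleigh (x : 'I_n -> R) :
  \sum_u \sum_v (adj G u v)%:R * x u * x v <= lambda R G * \sum_u x u ^+ 2.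
Proof.
have [_ /(_ x)] := spectral_radius_nonneg_symmetric n0 adj_tr adj_ge0.
by under eq_bigr do under eq_bigr do rewrite mxE.
Qed.

(** An eigenvector is divided by an entry of maximal modulus. Positivity is not claimed here; where
    it matters, it follows from the closeness of all entries to [y u0 = 1]. *)
Lemma lambda_eigenvector : exists (y : 'I_n -> R) (u0 : 'I_n),
  [/\ y u0 = 1, forall u, `|y u| <= 1 &
      forall u, \sum_v (adj G u v)%:R * y v = lambda R G * y u].
Proof.
have [/eigenvalueP[w wE w0] _] :=
  spectral_radius_nonneg_symmetric n0 adj_tr adj_ge0.
pose u0 : 'I_n := [arg max_(i > Ordinal n0) `|w 0 i|]%O.
have umax i : `|w 0 i| <= `|w 0 u0|.
  by rewrite /u0; case: Order.TotalTheory.arg_maxP => // j _; apply.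
have wu0 : w 0 u0 != 0.
  apply: contra_neq w0 => wu0; apply/rowP => i; rewrite mxE; apply/eqP.
  by rewrite -normr_eq0 eq_le normr_ge0 andbT (le_trans (umax i)) // wu0 normr0.
exists (fun u => w 0 u / w 0 u0), u0; split; first by rewrite divff.
  by move=> u; rewrite normf_div ler_pdivrMr ?normr_gt0 // mul1r.
move=> u; have /rowP/(_ u) := wE; rewrite !mxE mulrA => <-.
rewrite mulr_suml; apply: eq_bigr => v _.
by rewrite mxE adj_sym mulrA [w 0 v * _]mulrC.
Qed.

End GraphLambda.

(** * Edge sets as 0-1 matrices, and modifications as perturbations *)

Lemma adj_edges (T : finType) (G : sgraph T) (x y : T) :
  adj G x y = ([set x; y]%SET \in edges G).
Proof.
apply/idP/idP => [xy|].
  by rewrite inE; apply/existsP; exists x; apply/existsP; exists y; rewrite xy /=.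
rewrite inE => /existsP[a /existsP[b /andP[ab /eqP /setP E]]].
have := E x; have := E y; have := E a; have := E b; rewrite !inE !eqxx /= !orbT.
have nab : a != b by apply: contraTneq ab => ->; rewrite adj_irrefl.
by case/pred2P => eb; case/pred2P => ea; subst => //;
  [ rewrite eqxx in nab | rewrite adj_sym | rewrite eqxx in nab].
Qed.

Lemma card_edge (T : finType) (G : sgraph T) (e : {set T}) :
  e \in edges G -> #|e| = 2%N.
Proof.
rewrite inE => /existsP[a /existsP[b /andP[ab /eqP ->]]].
rewrite cards2; case: eqP ab => // ->.
by rewrite adj_irrefl.
Qed.

(** A set with two elements [a], [b] is counted by exactly the ordered pairs [(a, b)] and
    [(b, a)]. *)
Lemma sum_pairs_mem (R : realType) (T : finType) (A : {set {set T}}) :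
  (forall e, e \in A -> #|e| = 2%N) ->
  \sum_u \sum_v ([set u; v]%SET \in A)%:R = 2 * #|A|%:R :> R.
Proof.
move=> A2.
transitivity (\sum_(e in A) (\sum_u \sum_v ([set u; v]%SET == e)%:R) : R).
  rewrite [RHS]exchange_big; apply: eq_bigr => u _.
  rewrite [RHS]exchange_big; apply: eq_bigr => v _.
  rewrite -natr_sum; congr (_%:R).
  have [uvA|uvA] := boolP (_ \in A).
    rewrite (bigD1 _ uvA) /= eqxx big1 // => e /andP[_ ne].
    by rewrite eq_sym (negbTE ne).
  by rewrite big1 // => e eA; case: eqP uvA => // ->; rewrite eA.
rewrite (eq_bigr (fun=> 2)); first by rewrite sumr_const mulr_natr.
move=> e /A2/eqP/cards2P[a [b [ab ->]]].
rewrite pair_bigA -natr_sum; congr (_%:R); rewrite -big_mkcond.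
rewrite (eq_bigl [in [set (a, b); (b, a)]%SET]).
  by rewrite sum1_card cards2 xpair_eqE (negbTE ab).
case=> u v; rewrite !inE !xpair_eqE /fst /snd.
apply/eqP/orP => [/setP E|[] /andP[/eqP-> /eqP->] //]; last exact: setUC.
have := E u; have := E v; have := E a; have := E b.
rewrite !inE !eqxx !orbT /=.
by case/pred2P=> ?; case/pred2P=> ?; subst; rewrite ?eqxx ?orbT // in ab *; auto.
Qed.

(** [P] and [Q] indicate the added and the deleted pairs. Added pairs lie inside a part and deleted
    pairs cross, so the two never meet and the perturbation is exactly [P - Q]. *)
Lemma modification_adj (R : realType) (n r : nat) (part : 'I_n -> 'I_r)
    (G : sgraph 'I_n) (a1 a2 : nat) :
  modification part G a1 a2 ->
  exists P Q : 'I_n -> 'I_n -> bool,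
  [/\ forall u v, (adj G u v)%:R =
        (part u != part v)%:R + ((P u v)%:R - (Q u v)%:R) :> R,
      \sum_u \sum_v (P u v)%:R = 2 * a1%:R :> R &
      \sum_u \sum_v (Q u v)%:R = 2 * a2%:R :> R].
Proof.
move=> [A [D [/subsetP Acl cA /subsetP Ded cD GE]]].
exists (fun u v => [set u; v]%SET \in A), (fun u v => [set u; v]%SET \in D).
split; last 2 first.
- by rewrite sum_pairs_mem ?cA // => e /Acl; rewrite inE => /andP[/eqP].
- by rewrite sum_pairs_mem ?cD // => e /Ded; apply: card_edge.
move=> u v; rewrite adj_edges GE in_setU in_setD.
rewrite -(adj_edges (complete_multipartite part)) /= /cmp_rel.
have [uvD|_] := boolP (_ \in D).
  have := Ded _ uvD; rewrite -(adj_edges (complete_multipartite part)) /=.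
  rewrite /cmp_rel => nuv; rewrite nuv /=.
  have -> : ([set u; v]%SET \in A) = false.
    apply/negP => /Acl; rewrite inE => /andP[_ /existsP[i /subsetP si]].
    have := si u; have := si v; rewrite !inE !eqxx orbT /=.
    by move=> /(_ isT)/eqP vi /(_ isT)/eqP ui; rewrite ui vi eqxx in nuv.
  by rewrite add0r subrr.
rewrite subr0 /=; have [uvA|_] := boolP (_ \in A); last by rewrite orbF addr0.
rewrite orbT; move: (Acl _ uvA).
rewrite inE => /andP[_ /existsP[i /subsetP si]].
have := si u; have := si v; rewrite !inE !eqxx orbT /=.
by move=> /(_ isT)/eqP -> /(_ isT)/eqP ->; rewrite eqxx add0r.
Qed.

(** * Eigenvectors of perturbed complete multipartite graphs *)

Lemma sum_over_parts (R : realType) (n r : nat) (part : 'I_n -> 'I_r)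
    (f : 'I_n -> R) :
  \sum_u f u = \sum_i \sum_(u | part u == i) f u.
Proof. by rewrite (partition_big part xpredT). Qed.

Lemma sum_const_part (R : realType) (n r : nat) (part : 'I_n -> 'I_r) (c : R) i :
  \sum_(u | part u == i) c = #|vpart part i|%:R * c.
Proof.
rewrite sumr_const mulr_natl; congr (_ *+ _).
by apply: eq_card => u; rewrite inE.
Qed.

Lemma sum_card_parts (R : realType) (n r : nat) (part : 'I_n -> 'I_r) :
  \sum_i #|vpart part i|%:R = n%:R :> R.
Proof.
rewrite -[n in RHS]card_ord -sum1_card natr_sum (sum_over_parts part).
by apply: eq_bigr => i _; rewrite sum_const_part mulr1.
Qed.

Section PerturbedEigenvector.
Variables (R : realType) (n r : nat) (part : 'I_n -> 'I_r).
Variables (E : 'I_n -> 'I_n -> R) (l : R) (y : 'I_n -> R).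
Hypothesis eigen : forall u,
  \sum_v ((part u != part v)%:R + E u v) * y v = l * y u.

Let e u := \sum_v E u v * y v.
Let m i : R := #|vpart part i|%:R.
Let S := \sum_v y v.
Let s i := \sum_(v | part v == i) y v.

Lemma perturbed_eigen_entry u : l * y u = S - s (part u) + e u.
Proof.
rewrite -eigen /e; under eq_bigr do rewrite mulrDl.
rewrite big_split /=; congr (_ + _).
rewrite /S [X in _ = X - _](bigID (fun v => part v == part u)) /= addrAC subrr add0r.
rewrite [RHS]big_mkcond; apply: eq_bigr => v _; rewrite eq_sym.
by case: eqP => _; rewrite ?mul0r ?mul1r.
Qed.

Lemma perturbed_eigen_part i :
  (l + m i) * s i = m i * S + \sum_(u | part u == i) e u.
Proof.
have : \sum_(u | part u == i) l * y u =
       \sum_(u | part u == i) (S - s i + e u).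
  by apply: eq_bigr => u /eqP ui; rewrite perturbed_eigen_entry ui.
rewrite -mulr_sumr big_split /= sum_const_part -/(s i) -/(m i) => H.
by rewrite mulrDl H; ring.
Qed.

(** Eliminates the part sum [s] between the entry equation and the part equation. The first term
    depends on [u] only through the size of its part; the second is the error caused by [E]. *)
Lemma perturbed_eigen_solve u : l != 0 -> l + m (part u) != 0 ->
  y u = S / (l + m (part u)) +
    (e u - (\sum_(v | part v == part u) e v) / (l + m (part u))) / l.
Proof.
move=> l0 lm0.
have E1 := perturbed_eigen_entry u; have E2 := perturbed_eigen_part (part u).
apply: (mulfI l0); rewrite E1.
move: E2; set f := \sum_(v | _) e v; move: (s _) (e u) => si eu E2.
have -> : si = (m (part u) * S + f) / (l + m (part u)) by rewrite -E2 mulrC mulKf.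
by field; rewrite l0.
Qed.

(** The first summand bounds the change of [S / (l + m i)] from part to part, with [|S| <= n]. The
    second bounds the two error terms, as [|y| <= 1] keeps [e] and its part sums below [phi]. *)
Lemma perturbed_eigen_close (c phi d : R) u v : 0 < l -> 0 < c ->
  (forall i, c <= l + m i) -> (forall i j, m i - m j <= d) ->
  (forall u, `|y u| <= 1) -> \sum_u \sum_v `|E u v| <= phi ->
  y u - y v <= n%:R * d / c ^+ 2 + 2 * (phi + phi / c) / l.
Proof.
move=> l0 c0 cm md y1 Ephi.
have S1 : `|S| <= n%:R.
  apply: le_trans (ler_norm_sum _ _ _) _.
  rewrite -[X in X%:R]card_ord -sum1_card natr_sum; exact: ler_sum.
have phi0 : 0 <= phi.
  by apply: le_trans Ephi; apply: sumr_ge0 => w _; apply: sumr_ge0.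
have e1 w : `|e w| <= \sum_v `|E w v|.
  apply: le_trans (ler_norm_sum _ _ _) _; apply: ler_sum => z _.
  by rewrite normrM ler_piMr.
have ephi w : `|e w| <= phi.
  apply: le_trans (e1 w) _; apply: le_trans Ephi.
  by rewrite [leRHS](bigD1 w) //= lerDl; apply: sumr_ge0 => z _; apply: sumr_ge0.
have fphi i : `|\sum_(w | part w == i) e w| <= phi.
  apply: le_trans (ler_norm_sum _ _ _) _; apply: le_trans Ephi.
  rewrite [leRHS](bigID (fun w => part w == i)) /= ler_wpDr //.
    by apply: sumr_ge0 => z _; apply: sumr_ge0.
  by apply: ler_sum.
have lm0 i : 0 < l + m i by apply: lt_le_trans (cm i).
have err w : `|(e w - (\sum_(v | part v == part w) e v) / (l + m (part w))) / l|
    <= (phi + phi / c) / l.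
  rewrite normf_div [`|l|]gtr0_norm // ler_pM2r ?invr_gt0 //.
  apply: le_trans (ler_normB _ _) _; apply: lerD => //.
  rewrite normf_div; apply: ler_pM; rewrite ?invr_ge0 //.
  by rewrite gtr0_norm // lef_pV2 // posrE.
have main : S / (l + m (part u)) - S / (l + m (part v)) <= n%:R * d / c ^+ 2.
  have -> : S / (l + m (part u)) - S / (l + m (part v)) =
      S * (m (part v) - m (part u)) * ((l + m (part u))^-1 * (l + m (part v))^-1).
    by field; rewrite !(gt_eqF (lm0 _)).
  have nd : S * (m (part v) - m (part u)) <= n%:R * d.
    apply: le_trans (ler_norm _) _; rewrite normrM; apply: ler_pM => //.
    by rewrite ler_norml md andbT lerNl opprB md.
  have d0 : 0 <= d by apply: le_trans (md (part u) (part u)); rewrite subrr.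
  apply: le_trans (ler_wpM2r _ nd) _.
    by rewrite mulr_ge0 // invr_ge0 ltW.
  rewrite -exprVn expr2; apply: ler_wpM2l; first by rewrite mulr_ge0.
  by apply: ler_pM; rewrite ?invr_ge0 ?(ltW (lm0 _)) ?lef_pV2 ?posrE.
rewrite (perturbed_eigen_solve (u := u)) ?gt_eqF //.
rewrite (perturbed_eigen_solve (u := v)) ?gt_eqF //.
have := err u; have := err v; rewrite !ler_norml => /andP[v1 _] /andP[_ u2].
by lra.
Qed.

End PerturbedEigenvector.

Section CompleteMultipartite.
Variables (R : realType) (n r : nat) (part : 'I_n -> 'I_r).
Hypothesis n0 : (0 < n)%N.
Let K := complete_multipartite part.
Let l := lambda R K.
Let m i : R := #|vpart part i|%:R.

(** The term [+ 0] gives the equation the shape of the perturbed one with [E = 0]. *)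
Lemma multipartite_eigenvector : exists (x : 'I_n -> R) (u0 : 'I_n),
  [/\ x u0 = 1, forall u, `|x u| <= 1 &
      forall u, \sum_v ((part u != part v)%:R + 0) * x v = l * x u].
Proof.
have [x [u0 [x1 xle xe]]] := lambda_eigenvector R K n0.
by exists x, u0; split=> // u; rewrite -xe; under eq_bigr do rewrite addr0.
Qed.

(** Without perturbation the part sums are [m i / (l + m i) * S]; adding them up gives [S] times the
    left side equal to [S]. *)
Lemma multipartite_secular : 0 < l -> \sum_i m i / (l + m i) = 1.
Proof.
move=> l0; have [x [u0 [x1 xle xe]]] := multipartite_eigenvector.
have lm0 i : 0 < l + m i by rewrite ltr_wpDr // ler0n.
have E i := perturbed_eigen_part xe i.
have z0 i : \sum_(u | part u == i) \sum_(v : 'I_n) 0 * x v = 0.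
  by apply: big1 => u _; apply: big1 => v _; rewrite mul0r.
pose S := \sum_v x v.
have sE i : \sum_(v | part v == i) x v = m i / (l + m i) * S.
  have := E i; rewrite z0 addr0 -/(m i) -/S => H.
  by rewrite mulrAC -H mulrAC mulfV ?mul1r // gt_eqF.
have SS : S = (\sum_i m i / (l + m i)) * S.
  by rewrite {1}/S (sum_over_parts part) mulr_suml; apply: eq_bigr.
(* If [S = 0], all part sums vanish, and the equation at [u0] becomes [l = 0]. *)
have S0 : S != 0.
  apply/eqP => S0; have := perturbed_eigen_entry xe u0.
  rewrite sE -/S S0 mulr0 subr0 add0r x1 mulr1 big1 => [l00|v _].
    by rewrite l00 ltxx in l0.
  by rewrite mul0r.
by apply: (mulIf S0); rewrite -SS mul1r.
Qed.

Lemma sum_multipartite : \sum_u \sum_v (part u != part v)%:R =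
  n%:R ^+ 2 - \sum_i m i ^+ 2.
Proof.
have deg u : \sum_v (part u != part v)%:R = n%:R - m (part u).
  apply/eqP; rewrite eq_sym subr_eq -[m _]mulr1 -sum_const_part.
  rewrite [X in _ + X]big_mkcond -big_split /=.
  rewrite (eq_bigr (fun=> 1)) ?sumr_const ?card_ord // => v _.
  by rewrite eq_sym; case: eqP; rewrite ?addr0 ?add0r.
under eq_bigr do rewrite deg.
rewrite big_split /= sumr_const card_ord -[n%:R *+ n]mulr_natr -expr2.
congr (_ + _); rewrite sumrN; congr (- _).
rewrite (sum_over_parts part); apply: eq_bigr => i _.
rewrite (eq_bigr (fun=> m i)); first by rewrite sum_const_part expr2.
by move=> u /eqP ->.
Qed.

Lemma multipartite_degree_sum (M : R) : (forall i, m i <= M) ->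
  n%:R * (n%:R - M) <= \sum_u \sum_v (part u != part v)%:R.
Proof.
move=> mM; rewrite sum_multipartite mulrBr -expr2 lerD2l lerN2.
rewrite -(sum_card_parts _ part) mulr_suml; apply: ler_sum => i _.
by rewrite expr2 ler_wpM2l // ler0n.
Qed.

End CompleteMultipartite.

(** * Degree bounds for [lambda] and the first-order shift of an eigenvalue *)

Lemma lambda_ge_average_degree (R : realType) (n : nat) (G : sgraph 'I_n) :
  (0 < n)%N -> \sum_u \sum_v (adj G u v)%:R <= n%:R * lambda R G.
Proof.
move=> n0; have := lambda_rayleigh (R := R) G n0 (fun=> 1).
rewrite expr1n sumr_const card_ord mulrC.
by under eq_bigr do under eq_bigr do rewrite !mulr1.
Qed.

Lemma lambda_multipartite_ge (R : realType) (n r : nat) (part : 'I_n -> 'I_r)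
    (M : R) : (0 < n)%N -> (forall i, #|vpart part i|%:R <= M) ->
  n%:R - M <= lambda R (complete_multipartite part).
Proof.
move=> n0 /multipartite_degree_sum H.
rewrite -(@ler_pM2l _ n%:R) ?ltr0n //; apply: le_trans H _.
exact: lambda_ge_average_degree (complete_multipartite part) n0.
Qed.

(** At a vertex [u] with maximal entry 1, the eigenvalue is at most the degree of [u]. *)
Lemma lambda_multipartite_le (R : realType) (n r : nat) (part : 'I_n -> 'I_r)
    (b : R) : (0 < n)%N -> (forall i, b <= #|vpart part i|%:R) ->
  lambda R (complete_multipartite part) <= n%:R - b.
Proof.
move=> n0 bm; have [x [u [x1 xle xe]]] := multipartite_eigenvector R part n0.
rewrite -[leLHS]mulr1 -[X in _ * X]x1 -xe.
apply: (@le_trans _ _ (\sum_v (part u != part v)%:R)).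
  apply: ler_sum => v _; rewrite addr0 ler_piMr //.
  exact: le_trans (ler_norm _) (xle v).
rewrite lerBrDr; apply: le_trans (lerD (lexx _) (bm (part u))) _.
rewrite -[X in _ + X]mulr1 -sum_const_part [X in _ + X]big_mkcond -big_split /=.
rewrite (eq_bigr (fun=> 1)) ?sumr_const ?card_ord // => v _.
by rewrite eq_sym; case: eqP; rewrite ?addr0 ?add0r.
Qed.

(** By symmetry of [W], [(l' - l) * B = x^T E y] with [B] the inner product of [x] and [y]. Each
    entry of [E] thus has weight [x u * y v / B], which differs from [1 / n] by at most
    [eta / n]. *)
Lemma eigenvalue_shift (R : realType) (n : nat) (W E : 'I_n -> 'I_n -> R)
    (l l' delta eta : R) (x y : 'I_n -> R) : (0 < n)%N ->
  (forall u v, W u v = W v u) ->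
  (forall u, \sum_v W u v * x v = l * x u) ->
  (forall u, \sum_v (W u v + E u v) * y v = l' * y u) ->
  (forall u, 1 - delta <= x u <= 1) -> (forall u, 1 - delta <= y u <= 1) ->
  0 <= delta -> delta < 1 -> 1 <= (1 + eta) * (1 - delta) ^+ 2 ->
  `|l' - l - (\sum_u \sum_v E u v) / n%:R| <=
    (\sum_u \sum_v `|E u v|) * eta / n%:R.
Proof.
move=> n0 Wsym xe ye x1 y1 d0 d1 eta1.
have nR : 0 < n%:R :> R by rewrite ltr0n.
have dd : 0 < 1 - delta by rewrite subr_gt0.
have xy u v : (1 - delta) ^+ 2 <= x u * y v <= 1.
  have /andP[xl xu] := x1 u; have /andP[yl yu] := y1 v.
  have x0 := le_trans (ltW dd) xl; have y0 := le_trans (ltW dd) yl.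
  apply/andP; split; first by rewrite expr2; apply: ler_pM => //; apply: ltW.
  by rewrite -[leRHS]mulr1; apply: ler_pM.
pose B := \sum_u x u * y u.
have Bl : n%:R * (1 - delta) ^+ 2 <= B.
  rewrite mulr_natl -[X in _ *+ X]card_ord -sumr_const; apply: ler_sum => u _.
  by have /andP[] := xy u u.
have Bu : B <= n%:R.
  rewrite -[X in X%:R]card_ord -sum1_card natr_sum; apply: ler_sum => u _.
  by have /andP[] := xy u u.
have B0 : 0 < B by apply: lt_le_trans Bl; rewrite mulr_gt0 // exprn_gt0.
have key : (l' - l) * B = \sum_u \sum_v E u v * (x u * y v).
  rewrite mulrBl !mulr_sumr.
  have -> : \sum_u l' * (x u * y u) = \sum_u \sum_v (W u v + E u v) * (x u * y v).
    apply: eq_bigr => u _; rewrite mulrCA -ye mulr_sumr.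
    by apply: eq_bigr => v _; rewrite mulrCA.
  have -> : \sum_u l * (x u * y u) = \sum_u \sum_v W u v * (x u * y v).
    rewrite exchange_big; apply: eq_bigr => v _; rewrite mulrA -xe mulr_suml.
    by apply: eq_bigr => u _; rewrite Wsym mulrA.
  rewrite -sumrB; apply: eq_bigr => u _; rewrite -sumrB; apply: eq_bigr => v _.
  by ring.
have -> : l' - l - (\sum_u \sum_v E u v) / n%:R =
    \sum_u \sum_v E u v * (x u * y v / B - n%:R^-1).
  have -> : l' - l = (\sum_u \sum_v E u v * (x u * y v)) / B.
    by rewrite -key mulfK // gt_eqF.
  rewrite !mulr_suml -sumrB; apply: eq_bigr => u _.
  rewrite !mulr_suml -sumrB; apply: eq_bigr => v _.
  by rewrite mulrBr !mulrA.
apply: le_trans (ler_norm_sum _ _ _) _; rewrite !mulr_suml; apply: ler_sum => u _.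
apply: le_trans (ler_norm_sum _ _ _) _; rewrite !mulr_suml; apply: ler_sum => v _.
rewrite normrM -[leRHS]mulrA; apply: ler_wpM2l => //.
have /andP[xyl xyu] := xy u v.
have dd2 : 0 < (1 - delta) ^+ 2 by rewrite exprn_gt0.
have dle : (1 - delta) ^+ 2 <= 1 by nra.
have eta0 : 0 <= eta.
  rewrite leNgt; apply/negP => e0.
  have : (1 + eta) * (1 - delta) ^+ 2 < 1 by nra.
  by lra.
(* The weight lies between [(1 - delta) ^ 2 / n] and [1 / (n * (1 - delta) ^ 2)]. The choice of
   [eta] puts the former above [(1 - eta) / n] and the latter below [(1 + eta) / n]. *)
rewrite ler_norml; apply/andP; split.
  rewrite lerBrDr.
  apply: (@le_trans _ _ ((1 - delta) ^+ 2 / n%:R)).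
    have -> : - (eta / n%:R) + n%:R^-1 = (1 - eta) / n%:R by field; rewrite gt_eqF.
    by rewrite ler_pM2r ?invr_gt0 //; nra.
  by apply: ler_pM; rewrite ?invr_ge0 ?(ltW nR) ?(ltW dd2) ?lef_pV2 ?posrE.
rewrite lerBlDr.
have -> : eta / n%:R + n%:R^-1 = (eta + 1) / n%:R by field; rewrite gt_eqF.
rewrite ler_pdivrMr // mulrAC ler_pdivlMr //.
apply: le_trans (ler_wpM2r (ltW nR) xyu) _; rewrite mul1r.
apply: (@le_trans _ _ ((eta + 1) * (n%:R * (1 - delta) ^+ 2))).
  by rewrite mulrCA ler_peMr ?ler0n // addrC.
by apply: ler_wpM2l => //; lra.
Qed.

Lemma part_size_le (R : realType) (n r : nat) (part : 'I_n -> 'I_r) (d : R) i :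
  (forall i j, #|vpart part i|%:R - #|vpart part j|%:R <= d) ->
  r%:R * (#|vpart part i|%:R - d) <= n%:R.
Proof.
move=> md; rewrite -(sum_card_parts R part) mulr_natl.
rewrite -[X in _ *+ X]card_ord -sumr_const.
by apply: ler_sum => j _; have := md i j; lra.
Qed.

(** * Bounds for [lambda] of a modified complete multipartite graph *)

Section Modification.
Variables (R : realType) (n r : nat) (part : 'I_n -> 'I_r) (G : sgraph 'I_n).
Variables (a1 a2 : nat).
Hypotheses (n0 : (0 < n)%N) (modG : modification part G a1 a2).
Let K := complete_multipartite part.
Let alpha1 : R := a1%:R.
Let alpha2 : R := a2%:R.

Lemma lambda_modification_ge (M : R) : (forall i, #|vpart part i|%:R <= M) ->
  n%:R - M - 2 * alpha2 / n%:R <= lambda R G.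
Proof.
move=> mM; have [P [Q [GE PE QE]]] := modification_adj R modG.
have nR : 0 < n%:R :> R by rewrite ltr0n.
rewrite -(@ler_pM2l _ n%:R) //; apply: le_trans (lambda_ge_average_degree R G n0).
have -> : \sum_u \sum_v (adj G u v)%:R =
    \sum_u \sum_v (part u != part v)%:R + (2 * alpha1 - 2 * alpha2).
  rewrite -PE -QE -sumrB -big_split /=; apply: eq_bigr => u _.
  by rewrite -sumrB -big_split /=; apply: eq_bigr => v _; rewrite GE.
have := multipartite_degree_sum mM; have a0 : 0 <= alpha1 by rewrite ler0n.
have -> : n%:R * (n%:R - M - 2 * alpha2 / n%:R) =
    n%:R * (n%:R - M) - 2 * alpha2 by field; rewrite gt_eqF.
by lra.
Qed.

(** Here [phi] may be any common upper bound rather than the maximum, since (ii) also needs this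
    estimate for [7 * r * psi]. *)
Lemma lambda_modification_close (d phi : R) : (2 <= r)%N -> 10 ^+ 3 <= n%:R :> R ->
  alpha1 <= n%:R / 20 ^+ 3 -> alpha2 <= n%:R / 20 ^+ 3 ->
  (forall i j, #|vpart part i|%:R - #|vpart part j|%:R <= d) -> d <= phi ->
  2 * (alpha1 + alpha2) <= phi -> phi <= n%:R / 100 ->
  `|lambda R G - lambda R K - 2 * (alpha1 - alpha2) / n%:R| <=
    56 * (alpha1 + alpha2) * phi / n%:R ^+ 2.
Proof.
move=> r2 n1000 a1n a2n md dphi aphi phin.
have nR : 0 < n%:R :> R by rewrite ltr0n.
have a10 : 0 <= alpha1 by rewrite ler0n.
have a20 : 0 <= alpha2 by rewrite ler0n.
have phi0 : 0 <= phi by lra.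
(* A part has at most [n / r + d] vertices, with [r >= 2] and [d <= n / 100]. *)
have mle i : #|vpart part i|%:R <= n%:R * (51 / 100) :> R.
  have := part_size_le i md; have : 2 <= r%:R :> R by rewrite (ler_nat R 2).
  by move: (r%:R) (#|_|%:R) => rr mi; nra.
have mj i j : #|vpart part j|%:R <= #|vpart part i|%:R + phi.
  by have := md j i; lra.
have [x [xu [x1 xle xe]]] := multipartite_eigenvector R part n0.
have [y [yu [y1 yle ye]]] := lambda_eigenvector R G n0.
have [P [Q [GE PE QE]]] := modification_adj R modG.
pose E u v : R := (P u v)%:R - (Q u v)%:R.
have ye' u : \sum_v ((part u != part v)%:R + E u v) * y v = lambda R G * y u.
  by rewrite -ye; apply: eq_bigr => v _; rewrite GE.
have ElePQ : \sum_u \sum_v `|E u v| <= 2 * (alpha1 + alpha2).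
  rewrite mulrDr -PE -QE -big_split; apply: ler_sum => u _ /=.
  rewrite -big_split; apply: ler_sum => v _ /=.
  by apply: le_trans (ler_normB _ _) _; rewrite !normr_nat.
have EE : \sum_u \sum_v E u v = 2 * (alpha1 - alpha2).
  rewrite mulrBr -PE -QE -sumrB; apply: eq_bigr => u _ /=.
  by rewrite -sumrB.
have a2n' : 2 * alpha2 / n%:R <= 1 by rewrite ler_pdivrMr //; lra.
(* Serves both [K] and [G]; the [- 1] in the lower bound for [l] absorbs the loss [2 * alpha2 / n].
   Comparison with the entry 1 at [u0], with [l >= 0.48 n] and [l + m i >= 0.98 n], gives a
   deviation of at most [(1.05 + 4.2) * phi / n], rounded up to [6 * phi / n]. *)
have entries (l : R) (F : 'I_n -> 'I_n -> R) (z : 'I_n -> R) u0 :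
    (forall u, \sum_v ((part u != part v)%:R + F u v) * z v = l * z u) ->
    z u0 = 1 -> (forall u, `|z u| <= 1) -> \sum_u \sum_v `|F u v| <= phi ->
    (forall M, (forall i, #|vpart part i|%:R <= M) -> n%:R - M - 1 <= l) ->
    forall u, 1 - 6 * phi / n%:R <= z u <= 1.
  move=> ze z1 zle Fphi lge u; apply/andP; split; last first.
    exact: le_trans (ler_norm _) (zle u).
  have l48 : n%:R * (48 / 100) <= l by have := lge _ mle; lra.
  have lm i : n%:R * (98 / 100) <= l + #|vpart part i|%:R.
    by have := lge _ (mj i); lra.
  have l0 : 0 < l by lra.
  have c0 : 0 < n%:R * (98 / 100) :> R by lra.
  have md' i j : #|vpart part i|%:R - #|vpart part j|%:R <= phi.
    exact: le_trans dphi.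
  have := perturbed_eigen_close ze u0 u l0 c0 lm md' zle Fphi.
  rewrite z1; set T1 := _ * _ / _; set T2 := _ * _ / l => H.
  suff : T1 + T2 <= 6 * phi / n%:R by lra.
  have T1le : T1 <= 105 / 100 * phi / n%:R.
    rewrite /T1 ler_pdivrMr ?exprn_gt0 //.
    have -> : 105 / 100 * phi / n%:R * (n%:R * (98 / 100)) ^+ 2 =
      n%:R * phi * (105 / 100 * (98 / 100) ^+ 2) by field; rewrite gt_eqF.
    by apply: ler_peMr; [apply: mulr_ge0 => //; apply: ltW | lra].
  have phin1 : phi / (n%:R * (98 / 100)) <= phi * (2 / 10 ^+ 3).
    by rewrite ler_pdivrMr //; have := ler_wpM2l phi0 n1000; lra.
  have T2le : T2 <= 42 / 10 * phi / n%:R.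
    rewrite /T2 ler_pdivrMr // mulrAC ler_pdivlMr //.
    have h1 : 2 * (phi + phi / (n%:R * (98 / 100))) <= phi * (201 / 100) by lra.
    apply: le_trans (ler_wpM2r (ltW nR) h1) _.
    have := mulr_ge0 phi0 (ltW nR); have := ler_wpM2l phi0 l48; lra.
  have : 0 <= phi / n%:R by rewrite mulr_ge0 // invr_ge0 ltW.
  by move: T1le T2le; rewrite -!mulrA; set w := phi / n%:R; lra.
have xb := entries _ _ _ _ xe x1 xle.
have yb := entries _ _ _ _ ye' y1 yle.
have {}xb u : 1 - 6 * phi / n%:R <= x u <= 1.
  apply: xb => [|M mM].
    by rewrite big1 // => i _; rewrite big1 // => j _; rewrite normr0.
  by have := lambda_multipartite_ge n0 mM; lra.
have {}yb u : 1 - 6 * phi / n%:R <= y u <= 1.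
  apply: yb => [|M mM]; first exact: le_trans aphi.
  by have := lambda_modification_ge mM; lra.
pose t := phi / n%:R.
have t0 : 0 <= t by rewrite mulr_ge0 // invr_ge0 ltW.
have t1 : t <= 1 / 100 by rewrite ler_pdivrMr //; lra.
have xe' u : \sum_v (part u != part v)%:R * x v = lambda R K * x u.
  by rewrite -xe; apply: eq_bigr => v _; rewrite addr0.
have Wsym u v : (part u != part v)%:R = (part v != part u)%:R :> R.
  by rewrite eq_sym.
(* For [t <= 1 / 100], [28 * t] is admissible with [delta = 6 * t]; the factor 2 from ordered pairs
   turns 28 into 56. *)
have := eigenvalue_shift (eta := 28 * t) n0 Wsym xe' ye' xb yb.
rewrite EE -mulrA -/t => /(_ _ _ _)/le_trans; apply.
- by lra.
- by lra.
- have -> : (1 + 28 * t) * (1 - 6 * t) ^+ 2 =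
    1 + t * (16 - 300 * t + 1008 * t ^+ 2) by ring.
  have : 0 <= t * (16 - 300 * t + 1008 * t ^+ 2); last by lra.
  by apply: mulr_ge0 => //; have := sqr_ge0 t; lra.
have -> : 56 * (alpha1 + alpha2) * phi / n%:R ^+ 2 =
  2 * (alpha1 + alpha2) * (28 * t) / n%:R by rewrite /t; field; rewrite gt_eqF.
rewrite ler_pM2r ?invr_gt0 //; apply: ler_wpM2r => //; lra.
Qed.

(* AM-GM with weight 1/1000: [`|y_u y_v| <= N / 2000 + 500 (y_u y_v)^2 / N]
   where [N] is the squared norm of [y]. *)
Lemma lambda_modification_le :
  lambda R G <= lambda R K + (alpha1 + alpha2) / 10 ^+ 3 + 500.
Proof.
have [y [yu [y1 yle ye]]] := lambda_eigenvector R G n0.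
have [P [Q [GE PE QE]]] := modification_adj R modG.
pose N := \sum_u y u ^+ 2.
have N0 : 0 < N.
  rewrite /N (bigD1 yu) //= y1 expr1n ltr_wpDr //.
  by apply: sumr_ge0 => u _; apply: sqr_ge0.
rewrite -(ler_pM2r N0).
have -> : lambda R G * N = \sum_u \sum_v (adj G u v)%:R * y u * y v.
  rewrite mulr_sumr; apply: eq_bigr => u _; rewrite expr2 mulrA -ye mulr_suml.
  by apply: eq_bigr => v _; rewrite mulrAC.
have ray : \sum_u \sum_v (part u != part v)%:R * y u * y v <= lambda R K * N.
  exact: lambda_rayleigh K n0 y.
have amgm u v : ((P u v)%:R - (Q u v)%:R) * (y u * y v) <=
    ((P u v)%:R + (Q u v)%:R) * (N / (2 * 10 ^+ 3)) + 500 / N * (y u ^+ 2 * y v ^+ 2).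
  have h (s : R) : s <= N / (2 * 10 ^+ 3) + 500 / N * s ^+ 2.
    rewrite -subr_ge0.
    have -> : N / (2 * 10 ^+ 3) + 500 / N * s ^+ 2 - s =
      (s * 10 ^+ 3 - N) ^+ 2 / (2 * 10 ^+ 3 * N) by field; rewrite gt_eqF.
    by apply: divr_ge0; [exact: sqr_ge0 | lra].
  have h1 := h (y u * y v); have := h (- (y u * y v)); rewrite sqrrN => h2.
  have h0 : 0 <= 500 / N * (y u * y v) ^+ 2.
    by rewrite mulr_ge0 ?sqr_ge0 // divr_ge0 // ltW.
  rewrite -exprMn; case: (P u v); case: (Q u v) => /=;
    move: h0 h1 h2 N0; set A := 500 / N * _; lra.
have EE : \sum_u \sum_v ((P u v)%:R - (Q u v)%:R) * (y u * y v) <=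
    (2 * alpha1 + 2 * alpha2) * (N / (2 * 10 ^+ 3)) + 500 / N * N ^+ 2.
  rewrite -PE -QE -big_split mulr_suml expr2 {3}/N mulr_suml mulr_sumr.
  rewrite -big_split; apply: ler_sum => u _ /=.
  rewrite -big_split {2}/N !mulr_sumr mulr_suml -big_split; apply: ler_sum => v _ /=.
  exact: amgm.
have -> : \sum_u \sum_v (adj G u v)%:R * y u * y v =
    \sum_u \sum_v (part u != part v)%:R * y u * y v +
    \sum_u \sum_v ((P u v)%:R - (Q u v)%:R) * (y u * y v).
  rewrite -big_split; apply: eq_bigr => u _; rewrite -big_split.
  by apply: eq_bigr => v _; rewrite GE /=; ring.
have split_sum (a b c m : R) : m != 0 ->
    a * m + ((2 * b + 2 * c) * (m / (2 * 10 ^+ 3)) + 500 / m * m ^+ 2) =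
    (a + (b + c) / 10 ^+ 3 + 500) * m by move=> m0; field.
by rewrite -split_sum ?gt_eqF //; apply: lerD.
Qed.

End Modification.

(** * The secular equation and comparison with the Turan graph *)

(* Expands [1 / (l + m)] by second divided differences at [q] and [q + 1], which
   are exact for this function; the first-order terms cancel because
   [m] and [t] have the same sum. *)
Lemma secular_root_difference (R : realType) (I : finType) (m t : I -> R)
    (l mu q : R) : 0 < l -> 0 < mu -> 0 <= q -> (forall i, 0 <= m i) ->
  (forall i, t i = q \/ t i = q + 1) -> \sum_i m i = \sum_i t i ->
  \sum_i m i / (l + m i) = 1 -> \sum_i t i / (mu + t i) = 1 ->
  (mu - l) * \sum_i t i / ((mu + t i) * (l + t i)) =
  l * \sum_i (m i - q) * (m i - q - 1) / ((l + q) * (l + q + 1) * (l + m i)).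
Proof.
move=> l0 mu0 q0 m0 tq smt sm st.
have tge i : 0 <= t i by case: (tq i) => ->; lra.
have lm i : l + m i != 0 by rewrite gt_eqF //; have := m0 i; lra.
have lt i : l + t i != 0 by rewrite gt_eqF //; have := tge i; lra.
have mut i : mu + t i != 0 by rewrite gt_eqF //; have := tge i; lra.
have lq : l + q != 0 by rewrite gt_eqF //; lra.
have lq1 : l + q + 1 != 0 by rewrite gt_eqF //; lra.
have -> : (mu - l) * \sum_i t i / ((mu + t i) * (l + t i)) =
    \sum_i (t i / (l + t i) - t i / (mu + t i)).
  rewrite mulr_sumr; apply: eq_bigr => i _.
  by field; rewrite lt mut.
rewrite sumrB st -[X in _ - X = _]sm -sumrB mulr_sumr.
apply/eqP; rewrite -subr_eq0 -sumrB; apply/eqP.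
rewrite (eq_bigr (fun i => l / ((l + q) * (l + q + 1)) * (t i - m i))).
  by rewrite -mulr_sumr sumrB smt subrr mulr0.
move=> i _; move: (lm i) (lt i); case: (tq i) => -> h1 h2.
  by field; rewrite h1 lq lq1.
have lq1' : l + (q + 1) != 0 by rewrite addrA.
by field; rewrite h1 lq lq1.
Qed.

(** In the identity for [mu - l], only the terms of [i] and [j] are kept on the right. On the left,
    [T <= n / ((n - 1) * (l + q))], which produces the factor [1 - 1 / n] and cancels [l + q]. *)
Lemma secular_root_gain (R : realType) (I : finType) (m t : I -> R)
    (l mu q n M w : R) (i j : I) : 0 < l -> 0 < mu -> 0 <= q -> 1 < n ->
  (forall i, 0 <= m i) -> (forall i, t i = q \/ t i = q + 1) ->
  \sum_i m i = n -> \sum_i t i = n ->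
  \sum_i m i / (l + m i) = 1 -> \sum_i t i / (mu + t i) = 1 ->
  (forall i, n - 1 <= mu + t i) -> (forall i, m i <= M) ->
  (forall i, 0 <= (m i - q) * (m i - q - 1)) -> i != j -> 0 <= w ->
  w <= (m i - q) * (m i - q - 1) + (m j - q) * (m j - q - 1) ->
  (1 - n^-1) * (l * w / ((l + q + 1) * (l + M))) <= mu - l.
Proof.
move=> l0 mu0 q0 n1 m0 tq sm st sml stm mut mM mq ij w0 wle.
have := secular_root_difference l0 mu0 q0 m0 tq (etrans sm (esym st)) sml stm.
set T := \sum_i t i / _; set X := \sum_i _ / _ => E.
have lq : 0 < l + q by lra.
have lq1 : 0 < l + q + 1 by lra.
have lm a : 0 < l + m a by have := m0 a; lra.
have lM : 0 < l + M by have := mM i; have := lm i; lra.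
have tge a : 0 <= t a by case: (tq a) => ->; lra.
have c0 : 0 < (l + q) * (l + q + 1) by rewrite mulr_gt0.
have TE : T <= n / ((n - 1) * (l + q)).
  rewrite -st mulr_suml; apply: ler_sum => a _; apply: ler_wpM2l => //.
  have la : l + q <= l + t a by case: (tq a) => ->; lra.
  have := mut a; rewrite lef_pV2 ?posrE ?mulr_gt0 //; try lra.
  by move=> ma; apply: ler_pM => //; lra.
have XE : w / ((l + q) * (l + q + 1) * (l + M)) <= X.
  have term a : (m a - q) * (m a - q - 1) / ((l + q) * (l + q + 1) * (l + M)) <=
     (m a - q) * (m a - q - 1) / ((l + q) * (l + q + 1) * (l + m a)).
    apply: ler_wpM2l => //; rewrite lef_pV2 ?posrE ?mulr_gt0 //.
    by rewrite ler_pM2l // lerD2l.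
  rewrite /X (bigD1 i) //= (bigD1 j) 1?eq_sym //= addrA ler_wpDr //.
    apply: sumr_ge0 => a _; apply: divr_ge0 => //.
    by rewrite ltW // mulr_gt0.
  apply: le_trans (lerD (term i) (term j)); rewrite -mulrDl.
  by apply: ler_wpM2r => //; rewrite invr_ge0 ltW // mulr_gt0.
have X0 : 0 <= X.
  by apply: le_trans XE; apply: divr_ge0 => //; rewrite ltW // mulr_gt0.
have T0 : 0 < T.
  have sT : 0 < n / ((mu + q + 1) * (l + q + 1)).
    by apply: divr_gt0; [lra | apply: mulr_gt0; lra].
  apply: lt_le_trans sT _; rewrite -st mulr_suml; apply: ler_sum => a _.
  apply: ler_wpM2l => //; have := tge a => ta.
  rewrite lef_pV2 ?posrE ?mulr_gt0 //; try lra.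
  by apply: ler_pM; case: (tq a) ta => -> ta; lra.
(* The sign is required before [T] can be replaced by its upper bound. *)
have gap0 : 0 <= mu - l.
  by rewrite -(pmulr_lge0 _ T0) E mulr_ge0 // ltW.
have n0 : 0 < n by lra.
have n10 : 0 < n - 1 by lra.
have step : l * (w / ((l + q) * (l + q + 1) * (l + M))) <=
    (mu - l) * (n / ((n - 1) * (l + q))).
  apply: le_trans (ler_wpM2l gap0 TE); rewrite E.
  by apply: ler_wpM2l => //; apply: ltW.
have k0 : 0 <= (n - 1) * (l + q) / n by apply: divr_ge0; rewrite ltW // mulr_gt0.
have := ler_wpM2r k0 step.
have -> : (mu - l) * (n / ((n - 1) * (l + q))) * ((n - 1) * (l + q) / n) = mu - l.
  by field; rewrite !gt_eqF.
have -> : l * (w / ((l + q) * (l + q + 1) * (l + M))) * ((n - 1) * (l + q) / n) =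
    (1 - n^-1) * (l * w / ((l + q + 1) * (l + M))).
  by field; rewrite !gt_eqF.
by [].
Qed.

Lemma consecutive_int_prod_ge0 (R : realType) (a b : nat) :
  0 <= (a%:R - b%:R) * (a%:R - b%:R - 1) :> R.
Proof.
have [ba|ab] := ltnP b a.
  have : b%:R + 1 <= a%:R :> R by rewrite natr1 ler_nat.
  by move=> h; apply: mulr_ge0; lra.
have : a%:R <= b%:R :> R by rewrite ler_nat.
by move=> h; rewrite -mulrNN; apply: mulr_ge0; lra.
Qed.

(* If [x = y + 2 k], the excess over [2 k ^ 2] is [2 s (s - 1)] for the integer
   [s = y + k - q]. *)
Lemma spread_gain (R : realType) (x y q k : nat) : (y + 2 * k <= x)%N ->
  2 * k%:R ^+ 2 <=
    (x%:R - q%:R) * (x%:R - q%:R - 1) + (y%:R - q%:R) * (y%:R - q%:R - 1) :> R.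
Proof.
rewrite leq_eqVlt => /orP[/eqP <-|yx].
  rewrite natrD natrM.
  have -> : (y%:R + 2 * k%:R - q%:R) * (y%:R + 2 * k%:R - q%:R - 1) +
     (y%:R - q%:R) * (y%:R - q%:R - 1) = 2 * k%:R ^+ 2 +
     2 * (((y + k)%:R - q%:R) * ((y + k)%:R - q%:R - 1)) :> R.
    by rewrite natrD; ring.
  by rewrite lerDl mulr_ge0 // consecutive_int_prod_ge0.
(* With a spread of at least [2 k + 1], completing the square gives at least
   [((2 k + 1) ^ 2 - 1) / 2 = 2 k ^ 2 + 2 k]. *)
have h : y%:R + 2 * k%:R + 1 <= x%:R :> R by rewrite -natrM -natrD natr1 ler_nat.
have k0 : 0 <= k%:R :> R by rewrite ler0n.
move: h k0; move: (x%:R) (y%:R) (q%:R) (k%:R) => X Y Q k0 h k1.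
have -> : (X - Q) * (X - Q - 1) + (Y - Q) * (Y - Q - 1) =
  ((X - Y) ^+ 2 - 1 + (X + Y - 2 * Q - 1) ^+ 2) / 2 by field.
have := sqr_ge0 (X + Y - 2 * Q - 1).
have : (2 * k0 + 1) ^+ 2 <= (X - Y) ^+ 2 by rewrite lerXn2r ?nnegrE //; lra.
have -> : (2 * k0 + 1) ^+ 2 = 4 * k0 ^+ 2 + 4 * k0 + 1 by ring.
lra.
Qed.

(** Provides a gain in terms of the spread itself, for spreads much larger than [k]. *)
Lemma spread_gain_square (R : realType) (x y q : R) :
  ((x - y) ^+ 2 - 1) / 2 <= (x - q) * (x - q - 1) + (y - q) * (y - q - 1).
Proof.
have -> : (x - q) * (x - q - 1) + (y - q) * (y - q - 1) =
  ((x - y) ^+ 2 - 1 + (x + y - 2 * q - 1) ^+ 2) / 2 by field.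
by have := sqr_ge0 (x + y - 2 * q - 1); lra.
Qed.

(** The residue classes of [turan_part], typed in ['I_r] so that the results on partitions into [r]
    parts apply. *)
Definition turan_ord (n r : nat) (r0 : (0 < r)%N) (u : 'I_n) : 'I_r :=
  Ordinal (ltn_pmod u r0).

Lemma lambda_turan_ord (R : realType) (n r : nat) (r0 : (0 < r)%N) :
  lambda R (turan n r) = lambda R (complete_multipartite (@turan_ord n r r0)).
Proof.
by congr (spectral_radius _); apply/matrixP => u v; rewrite !mxE.
Qed.

Lemma card_turan_ord (n r : nat) (r0 : (0 < r)%N) (i : 'I_r) :
  #|vpart (@turan_ord n r r0) i| = (n %/ r + (i < n %% r))%N.
Proof.
by rewrite -card_turan_part //; apply: eq_card => u.
Qed.

Section TuranGain.
Variables (R : realType) (n r : nat) (part : 'I_n -> 'I_r).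
Let l := lambda R (complete_multipartite part).
Let mu := lambda R (turan n r).
Let q := (n %/ r)%N.

Lemma lambda_turan_ge : (0 < n)%N -> (0 < r)%N -> n%:R - q%:R - 1 <= mu.
Proof.
move=> n0 r0; rewrite /mu (lambda_turan_ord R n r0) -addrA -opprD.
apply: lambda_multipartite_ge => // i.
by rewrite card_turan_ord natr1 ler_nat -[q.+1]addn1 leq_add2l leq_b1.
Qed.

Lemma turan_gain (M w : R) (i j : 'I_r) : (2 < n)%N -> (1 < r)%N -> 0 < l ->
  (forall i, #|vpart part i|%:R <= M) -> i != j -> 0 <= w ->
  w <= (#|vpart part i|%:R - q%:R) * (#|vpart part i|%:R - q%:R - 1) +
       (#|vpart part j|%:R - q%:R) * (#|vpart part j|%:R - q%:R - 1) ->
  (1 - n%:R^-1) * (l * w / ((l + q%:R + 1) * (l + M))) <= mu - l.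
Proof.
move=> n2 r1 l0 mM ij w0 wle.
have n1 : (1 < n)%N by apply: ltnW.
have n0 : (0 < n)%N by apply: ltnW.
have r0 : (0 < r)%N by apply: ltnW.
pose T := @turan_ord n r r0.
have qn : (2 * q <= n)%N.
  by apply: leq_trans (leq_trunc_div n r); rewrite mulnC leq_mul2l r1 orbT.
(* Since [q <= n / 2] and [n >= 3], [n - q - 1] is positive. *)
have mu0 : 0 < mu.
  have := lambda_turan_ge n0 r0.
  have q2 : 2 * q%:R <= n%:R :> R by rewrite -natrM ler_nat.
  have : 3 <= n%:R :> R by rewrite (ler_nat R 3).
  by lra.
have tq a : #|vpart T a|%:R = q%:R :> R \/ #|vpart T a|%:R = q%:R + 1 :> R.
  rewrite card_turan_ord -/q; case: (_ < _)%N; last by left; rewrite addn0.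
  by right; rewrite addn1 natr1.
have lT : mu = lambda R (complete_multipartite T) by apply: lambda_turan_ord.
have nR1 : 1 < n%:R :> R by rewrite ltr1n.
have mun a : n%:R - 1 <= mu + #|vpart T a|%:R.
  by have := lambda_turan_ge n0 r0; case: (tq a) => ->; lra.
have secT : \sum_a #|vpart T a|%:R / (mu + #|vpart T a|%:R) = 1.
  by rewrite lT; apply: multipartite_secular => //; rewrite -lT.
exact: (secular_root_gain l0 mu0 (ler0n R q) nR1 (fun a => ler0n R _) tq
  (sum_card_parts R part) (sum_card_parts R T) (multipartite_secular n0 l0)
  secT mun mM (fun a => consecutive_int_prod_ge0 R _ q) ij w0 wle).
Qed.

End TuranGain.

(** * Numerical lower bounds for the gain [mu - l] *)

Lemma gain_factor_le (R : realType) (n l q M N w w' c e : R) : 0 < l -> 0 <= q ->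
  0 < l + M -> l + M <= N -> 0 <= c -> c * (l + q + 1) <= l -> 0 <= e ->
  e <= 1 - n^-1 -> 0 <= w' -> w' <= w ->
  e * (c * w' / N) <= (1 - n^-1) * (l * w / ((l + q + 1) * (l + M))).
Proof.
move=> l0 q0 lM lMN c0 cl e0 en w0 ww.
have N0 : 0 < N by apply: lt_le_trans lMN.
have lq : 0 < l + q + 1 by lra.
apply: ler_pM => //.
  by apply: divr_ge0; [apply: mulr_ge0 | apply: ltW].
have -> : l * w / ((l + q + 1) * (l + M)) = l / (l + q + 1) * w / (l + M).
  by field; rewrite !gt_eqF.
apply: ler_pM; rewrite ?invr_ge0 ?(ltW N0) ?mulr_ge0 ?lef_pV2 ?posrE //.
by apply: ler_pM => //; rewrite ler_pdivlMr.
Qed.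

(** With [D = d / n], the three factors are estimated by [1 - 1 / n >= 1 - D / 2], [l / (l + q + 1)
    >= (1 - 1 / r) * (1 - 3 * D)] and [l + M <= n * (1 + D)]. The fourth power of [1 - 4 * D]
    absorbs all losses. *)
Lemma near_turan_gain (R : realType) (n r k d l q M x : R) :
  10 ^+ 3 <= n -> 2 <= r -> 1 <= k -> 2 * k <= d -> d <= n / 100 ->
  4 * d / n <= x -> x <= 1 -> 0 <= q -> r * q <= n -> 0 < l -> n - q - d <= l ->
  0 < l + M -> l + M <= n + d ->
  2 * (r - 1) * k ^+ 2 / (r * n) * (1 - x) ^+ 4 <=
    (1 - n^-1) * (l * (2 * k ^+ 2) / ((l + q + 1) * (l + M))).
Proof.
move=> n3 r2 k1 kd dn dx x1 q0 rq l0 ll lM lMn.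
have n0 : 0 < n by lra.
have r0 : 0 < r by lra.
have k20 : 0 <= 2 * k ^+ 2 by rewrite mulr_ge0 // sqr_ge0.
pose D := d / n; pose rho := r^-1.
have Dn : D * n = d by rewrite /D divfK // gt_eqF.
have D0 : 0 <= D by apply: divr_ge0; lra.
have D1 : D <= 1 / 100 by rewrite /D ler_pdivrMr //; lra.
have Dx : 4 * D <= x by rewrite /D mulrA.
have rho0 : 0 <= rho by rewrite invr_ge0 ltW.
have rho2 : rho <= 1 / 2 by rewrite /rho -[r^-1]mul1r ler_pdivrMr //; lra.
have qrho : q <= n * rho by rewrite /rho ler_pdivlMr // mulrC.
have nV : n^-1 <= D / 2.
  by rewrite -[n^-1]mul1r ler_pdivrMr // mulrAC Dn; lra.
pose beta := (1 - rho) * (1 - 3 * D).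
have beta0 : 0 <= beta by apply: mulr_ge0; lra.
have beta1 : beta <= 1.
  by rewrite -[leRHS]mulr1; apply: ler_pM; lra.
(* As [beta <= 1], it suffices to check the least value [n - q - d] of [l], that is
   [beta * (n - d + 1) <= n - q - d]; here [d >= 2] gives [n - d + 1 <= n - d / 2]. *)
have betal : beta * (l + q + 1) <= l.
  have h1 : (1 - beta) * (n - q - d) <= (1 - beta) * l.
    by apply: ler_wpM2l => //; lra.
  have h2 : beta * (n - d / 2) <= n - q - d.
    have -> : beta * (n - d / 2) =
        (1 - rho) * n - (1 - rho) * (7 / 2 * d - 3 / 2 * D * d).
      by rewrite /beta -Dn; field.
    have h3 : D * d <= 1 / 100 * d by apply: ler_wpM2r => //; lra.
    have h4 : 1 / 2 * (2 * d) <= (1 - rho) * (7 / 2 * d - 3 / 2 * D * d).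
      by apply: ler_pM; lra.
    by lra.
  have h5 : beta * (n - d + 1) <= beta * (n - d / 2).
    by apply: ler_wpM2l => //; lra.
  by lra.
apply: le_trans (gain_factor_le (N := n * (1 + D)) (c := beta) (e := 1 - D / 2)
  (w' := 2 * k ^+ 2) l0 q0 lM _ beta0 betal _ _ k20 (lexx _)); try lra.
have -> : 2 * (r - 1) * k ^+ 2 / (r * n) * (1 - x) ^+ 4 =
    2 * k ^+ 2 * (1 - rho) / n * (1 - x) ^+ 4.
  by rewrite /rho; field; rewrite !gt_eqF.
have D1' : 0 < 1 + D by lra.
have -> : (1 - D / 2) * (beta * (2 * k ^+ 2) / (n * (1 + D))) =
    2 * k ^+ 2 * (1 - rho) / n * ((1 - D / 2) * (1 - 3 * D) / (1 + D)).
  by rewrite /beta; field; rewrite !gt_eqF.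
apply: ler_wpM2l.
  by apply: divr_ge0; rewrite ?(ltW n0) // mulr_ge0 //; lra.
have y0 : 0 <= 1 - 4 * D by lra.
have xy : (1 - x) ^+ 4 <= (1 - 4 * D) ^+ 4 by rewrite lerXn2r ?nnegrE //; lra.
apply: le_trans xy _; rewrite ler_pdivlMr //.
(* Two of the four factors pay for the numerator, the other two for [1 + D]. *)
have c1 : (1 - 4 * D) * (1 - 4 * D) <= (1 - D / 2) * (1 - 3 * D).
  by apply: ler_pM; lra.
have -> : (1 - 4 * D) ^+ 4 * (1 + D) =
  (1 - 4 * D) * (1 - 4 * D) * ((1 - 4 * D) ^+ 2 * (1 + D)) by ring.
rewrite -[leRHS]mulr1; apply: ler_pM => //.
- by rewrite mulr_ge0.
- by apply: mulr_ge0; [exact: sqr_ge0 | exact: ltW].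
have y1 : (1 - 4 * D) ^+ 2 <= 1 - 4 * D.
  by rewrite expr2 -[leRHS]mulr1; apply: ler_wpM2l => //; lra.
apply: le_trans (ler_wpM2r (ltW D1') y1) _.
by have := sqr_ge0 D; lra.
Qed.

(** Only the order [d ^ 2 / n] matters here. From [d >= 2], [(d ^ 2 - 1) / 2 >= 3 / 8 * d ^ 2], and
    [9 / 10 * 3 / 8 = 27 / 80] exceeds [1 / 3]. *)
Lemma far_turan_gain (R : realType) (n d l q M c b : R) :
  10 ^+ 3 <= n -> 2 <= d -> 0 < l -> 0 <= q -> 0 < l + M -> l + M <= b * n ->
  0 <= c -> c * (l + q + 1) <= l -> 0 < b ->
  1 / 3 * c / b * d ^+ 2 / n <=
    (1 - n^-1) * (l * ((d ^+ 2 - 1) / 2) / ((l + q + 1) * (l + M))).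
Proof.
move=> n3 d2 l0 q0 lM lMn c0 cl b0.
have n0 : 0 < n by lra.
have d4 : 4 <= d ^+ 2.
  have -> : 4 = 2 ^+ 2 :> R by ring.
  by rewrite lerXn2r ?nnegrE //; lra.
have nV : n^-1 <= 1 / 10 by rewrite -[n^-1]mul1r ler_pdivrMr //; lra.
apply: le_trans (gain_factor_le (N := b * n) (c := c) (e := 9 / 10)
  (w' := 3 / 8 * d ^+ 2) l0 q0 lM lMn c0 cl _ _ _ _); try lra.
have -> : 9 / 10 * (c * (3 / 8 * d ^+ 2) / (b * n)) =
    27 / 80 * (c / b * d ^+ 2 / n) by field; rewrite !gt_eqF.
have -> : 1 / 3 * c / b * d ^+ 2 / n = 1 / 3 * (c / b * d ^+ 2 / n) by rewrite -!mulrA.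
apply: ler_wpM2r; last by lra.
apply: divr_ge0; last by lra.
by apply: mulr_ge0; [apply: divr_ge0; lra | exact: sqr_ge0].
Qed.

(** The cube in [(10 * r) ^ 3] leaves [r * psi <= (n / 10 ^ 3) * (4 / r ^ 2)], and [r >= 2]. *)
Lemma psi_bound (R : realType) (r n c psi : R) : 2 <= r -> 0 <= n ->
  c = n / (10 * r) ^+ 3 -> psi <= 4 * c -> c <= n / 20 ^+ 3 /\ r * psi <= n / 10 ^+ 3.
Proof.
move=> r2 n0 -> psic.
have r0 : 0 < r by lra.
have r24 : 4 <= r ^+ 2.
  have -> : 4 = 2 ^+ 2 :> R by ring.
  by rewrite lerXn2r ?nnegrE //; lra.
split.
  apply: ler_wpM2l => //; rewrite lef_pV2 ?posrE ?exprn_gt0 ?mulr_gt0 //.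
  by rewrite lerXn2r ?nnegrE //; lra.
apply: le_trans (ler_wpM2l (ltW r0) psic) _.
have -> : r * (4 * (n / (10 * r) ^+ 3)) = n / 10 ^+ 3 * (4 / r ^+ 2).
  by field; rewrite gt_eqF.
rewrite ler_piMr ?ler_pdivrMr ?mul1r ?exprn_gt0 //.
by apply: divr_ge0 => //; apply: exprn_ge0.
Qed.

(** For [r = 1] both estimates fail: [K] has no edges, and one added edge has spectral radius 1,
    against a claimed value of [2 / n + O(n ^ -2)]. *)
Theorem theorem1p7 (R : realType) (r : nat) (hr : (2 <= r)%N) :
  exists N : nat, forall n : nat, (N <= n)%N ->
  forall (ns : r.-tuple nat) (part : 'I_n -> 'I_r) (G : sgraph 'I_n)
    (a1 a2 : nat),
  sorted geq ns ->
  has_part_sizes part ns ->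
  modification part G a1 a2 ->
  Num.max a1%:R a2%:R <= n%:R / (10 * r%:R) ^+ 3 :> R ->
  let K := complete_multipartite part in
  let n1 : R := (nth 0%N ns 0)%:R in
  let nr : R := (nth 0%N ns r.-1)%:R in
  let alpha1 : R := a1%:R in
  let alpha2 : R := a2%:R in
  (n1 - nr <= n%:R / 100 ->
    let phi := Num.max (n1 - nr) (2 * (alpha1 + alpha2)) in
    `| lambda R G - lambda R K - 2 * (alpha1 - alpha2) / n%:R |
      <= 56 * (alpha1 + alpha2) * phi / n%:R ^+ 2)
  /\
  (forall k : nat,
    2 * k%:R <= n1 - nr ->
    k%:R <= n%:R / (10 * r%:R) ^+ 3 :> R ->
    let psi := Num.max (3 * k%:R) (2 * (alpha1 + alpha2)) in
    lambda R G <= lambda R (turan n r)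
      + 2 * (alpha1 - alpha2) / n%:R
      - 2 * (r%:R - 1) * k%:R ^+ 2 / (r%:R * n%:R)
        * (1 - 28 * r%:R * psi / n%:R) ^+ 4
      + 56 * (alpha1 + alpha2) * (7 * r%:R * psi) / n%:R ^+ 2).
Proof.
(* From [10 ^ 9] on, the gain [2 * n / 10 ^ 6] available for a spread above [n / 100] outweighs the
   constant 500 of [lambda_modification_le] and the remaining errors. *)
exists (Num.bound (10 ^+ 9 : R)) => n nN ns part G a1 a2 srt sizes modG amax.
move=> K n1 nr alpha1 alpha2.
have n9 : 10 ^+ 9 <= n%:R :> R.
  apply: le_trans (ltW (archi_boundP _)) _; first exact: exprn_ge0.
  by rewrite ler_nat.
have n3 : 10 ^+ 3 <= n%:R :> R by lra.
have n3nat : (2 < n)%N by rewrite -(ltr_nat R); lra.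
have n0 : (0 < n)%N by apply: ltn_trans n3nat.
have nR : 0 < n%:R :> R by rewrite ltr0n.
have r2 : 2 <= r%:R :> R by rewrite (ler_nat R 2).
have r0 : (0 < r)%N by apply: leq_trans hr.
have mE i : #|vpart part i| = nth 0%N ns i by rewrite sizes (tnth_nth 0%N).
have nth_anti i j : (i <= j)%N -> (j < r)%N -> (nth 0 ns j <= nth 0 ns i)%N.
  move=> ij jr.
  have geqT : transitive geq by move=> a b c ba cb; apply: leq_trans cb ba.
  apply: (sorted_leq_nth geqT leqnn 0%N srt) => //; rewrite inE size_tuple //.
  exact: leq_ltn_trans jr.
have mle i : #|vpart part i|%:R <= n1 by rewrite mE ler_nat nth_anti.
have mge i : nr <= #|vpart part i|%:R.
  by rewrite mE ler_nat nth_anti // -ltnS ?prednK.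
pose i0 : 'I_r := Ordinal r0.
have rp : (r.-1 < r)%N by rewrite prednK.
pose i1 : 'I_r := Ordinal rp.
have i01 : i0 != i1 by rewrite -val_eqE /= eq_sym -lt0n -ltnS prednK.
pose q := (n %/ r)%N.
have rq : r%:R * q%:R <= n%:R :> R.
  by rewrite -natrM ler_nat mulnC leq_trunc_div.
have q0 : 0 <= q%:R :> R by rewrite ler0n.
have q2 : 2 * q%:R <= n%:R :> R.
  by apply: le_trans rq; apply: ler_wpM2r.
have nrq : nr <= q%:R.
  rewrite ler_nat leq_divRL // mulnC -(ler_nat R) natrM -(sum_card_parts R part).
  rewrite mulr_natl -[X in _ *+ X]card_ord -sumr_const.
  by apply: ler_sum => j _; apply: mge.
have n1n : n1 <= n%:R.
  by rewrite /n1 -(mE i0) ler_nat -[leqRHS]card_ord max_card.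
have md i j : #|vpart part i|%:R - #|vpart part j|%:R <= n1 - nr.
  by have := mle i; have := mge j; lra.
have a10 : 0 <= alpha1 by rewrite ler0n.
have a20 : 0 <= alpha2 by rewrite ler0n.
move: amax; rewrite ge_max => /andP[a1c a2c].
pose l := lambda R K; pose mu := lambda R (turan n r).
have lge : n%:R - n1 <= l by apply: lambda_multipartite_ge.
have lle : l <= n%:R - nr by apply: lambda_multipartite_le.
have nr0 : 0 <= nr by rewrite ler0n.
have [c20 _] := psi_bound (psi := 0) r2 (ltW nR) erefl
  (mulr_ge0 (ler0n R 4) (le_trans (ler0n R a1) a1c)).
have close phi : n1 - nr <= phi -> 2 * (alpha1 + alpha2) <= phi ->
    phi <= n%:R / 100 ->
    `|lambda R G - l - 2 * (alpha1 - alpha2) / n%:R| <=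
      56 * (alpha1 + alpha2) * phi / n%:R ^+ 2.
  by move=> h1 h2 h3; apply: (lambda_modification_close n0 modG hr n3 _ _ md) => //;
    apply: le_trans c20.
have alphan : 2 * (alpha1 + alpha2) <= n%:R / 100.
  by have := le_trans a1c c20; have := le_trans a2c c20; rewrite -/alpha1 -/alpha2; lra.
split=> [dn|k kd kc].
  cbv zeta; by apply: close; rewrite ?le_max ?lexx ?orbT // ge_max dn.
pose psi := Num.max (3 * k%:R) (2 * (alpha1 + alpha2)).
have mu_ge : n%:R - q%:R - 1 <= mu by apply: lambda_turan_ge.
have gain (w : R) : 0 < l -> 0 <= w ->
    w <= (n1 - q%:R) * (n1 - q%:R - 1) + (nr - q%:R) * (nr - q%:R - 1) ->
    (1 - n%:R^-1) * (l * w / ((l + q%:R + 1) * (l + n1))) <= mu - l.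
  move=> l0 w0 wle; apply: (turan_gain (i := i0) (j := i1)) => //.
  by rewrite !mE.
have k0 : 0 <= k%:R :> R by rewrite ler0n.
have psik : 3 * k%:R <= psi by rewrite le_max lexx.
have psia : 2 * (alpha1 + alpha2) <= psi by rewrite le_max lexx orbT.
have psi0 : 0 <= psi by lra.
have psic : psi <= 4 * (n%:R / (10 * r%:R) ^+ 3).
  rewrite ge_max; move: a1c a2c; rewrite -/alpha1 -/alpha2.
  by set c := n%:R / _ in kc * => h1 h2; apply/andP; split; lra.
have [_ rpsi] := psi_bound r2 (ltW nR) erefl psic.
pose x := 28 * r%:R * psi / n%:R.
have x0 : 0 <= x by rewrite !mulr_ge0 ?invr_ge0 // ltW.
have x1 : x <= 1 by rewrite /x ler_pdivrMr //; lra.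
pose z := (1 - x) ^+ 4.
have z0 : 0 <= z by apply: exprn_ge0; lra.
have z1 : z <= 1 by apply: exprn_ile1; lra.
pose kap := 2 * (r%:R - 1) * k%:R ^+ 2 / (r%:R * n%:R) * z.
have kaple : kap <= 2 * k%:R ^+ 2 / n%:R.
  rewrite -[leRHS]mulr1; apply: ler_pM => //.
    by rewrite divr_ge0 ?mulr_ge0 ?sqr_ge0 ?ler0n //; lra.
  rewrite ler_pdivrMr ?mulr_gt0 //; last by lra.
  have -> : 2 * k%:R ^+ 2 / n%:R * (r%:R * n%:R) = 2 * k%:R ^+ 2 * r%:R :> R.
    by field; rewrite gt_eqF.
  by have := sqr_ge0 (k%:R : R); lra.
have err0 : 0 <= 56 * (alpha1 + alpha2) * (7 * r%:R * psi) / n%:R ^+ 2.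
  by rewrite divr_ge0 ?mulr_ge0 ?ler0n ?addr_ge0 // exprn_ge0 // ltW.
cbv zeta; rewrite -/psi -/x -/z -/kap -/mu.
(* The gain with [w = 0]: the Turan graph has the larger eigenvalue. *)
have lmu : l <= mu.
  have [l0|l0] := ltP 0 l; last by lra.
  have := gain 0 l0 (lexx _) (addr_ge0 (consecutive_int_prod_ge0 _ _ _)
     (consecutive_int_prod_ge0 _ _ _)).
  by rewrite mulr0 mul0r mulr0 subr_ge0.
pose d := n1 - nr; pose t := 2 * (alpha1 - alpha2) / n%:R.
set err := _ / n%:R ^+ 2 in err0 *; rewrite -/t.
have lMn : l + n1 <= n%:R + d by rewrite /d; lra.
have lM : 0 < l + n1 by lra.
have ql1 : n%:R - q%:R - d <= l by rewrite /d; lra.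
have wsq : (d ^+ 2 - 1) / 2 <=
    (n1 - q%:R) * (n1 - q%:R - 1) + (nr - q%:R) * (nr - q%:R - 1).
  exact: spread_gain_square.
have wsq0 : 2 <= d -> 0 <= (d ^+ 2 - 1) / 2.
  by move=> d2; apply: divr_ge0 => //; rewrite subr_ge0 exprn_ege1 //; lra.
have [dn|dn] := ltP (n%:R / 100) d.
  have G_le : lambda R G <= l + (alpha1 + alpha2) / 10 ^+ 3 + 500.
    exact: lambda_modification_le.
  have gap : 2 * n%:R / 10 ^+ 6 <= mu - l.
    (* A small [l] is far below [mu >= n / 2 - 1] already; otherwise [l / (l + q + 1) >= 1 / 4]. *)
    have [l4|l4] := leP l (n%:R / 4).
      by clear - l4 mu_ge q2 n9; lra.
    have l0 : 0 < l by clear - l4 nR; lra.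
    have d2 : 2 <= d by clear - dn n9; lra.
    apply: le_trans (gain _ l0 (wsq0 d2) wsq).
    apply: le_trans (far_turan_gain (c := 1 / 4) (b := 2) n3 d2 l0 q0 lM _ _ _ _).
    - have dd : (n%:R / 100) ^+ 2 <= d ^+ 2.
        by rewrite lerXn2r ?nnegrE; clear - nR d2 dn; lra.
      rewrite ler_pdivlMr //; clear - dd nR; have := sqr_ge0 (n%:R : R); lra.
    - by clear - lle nr0 n1n; lra.
    - by clear; lra.
    - by clear - l4 q2 n9; lra.
    - by [].
  have t1 : -1 <= t.
    rewrite /t ler_pdivlMr //; clear - alphan a10 a20 nR; lra.
  have kapn : kap <= n%:R / 10 ^+ 7.
    apply: le_trans kaple _; rewrite ler_pdivrMr //.
    have kn := le_trans kc c20.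
    have kk : k%:R ^+ 2 <= (n%:R / 20 ^+ 3) ^+ 2 :> R.
      by rewrite lerXn2r ?nnegrE; clear - nR kn k0; lra.
    by clear - kk nR; have := sqr_ge0 (n%:R : R); lra.
  have an : alpha1 + alpha2 <= n%:R / 20 ^+ 3 + n%:R / 20 ^+ 3.
    by apply: lerD; [exact: le_trans a1c c20 | exact: le_trans a2c c20].
  by clear - G_le gap t1 kapn an n9 err0; lra.
(* If nothing is modified and [k = 0], the claim reduces to [l <= mu]. Setting this case aside
   ensures [psi >= 2]. *)
have [/eqP|pos] := eqVneq (a1 + a2 + k)%N 0%N.
  rewrite !addn_eq0 => /andP[/andP[/eqP a1z /eqP a2z] /eqP kz].
  have := close (n%:R / 100) dn alphan (lexx _).
  rewrite -/t /alpha1 /alpha2 a1z a2z addr0 mulr0 !mul0r ler_norml => /andP[_].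
  move: kaple; rewrite kz expr0n mulr0 mul0r.
  by clear - lmu err0; lra.
have l0 : 0 < l by clear - ql1 q2 dn nR; lra.
have psi2 : 2 <= psi.
  have : 1 <= alpha1 + alpha2 + k%:R.
    by rewrite -!natrD (ler_nat R 1) lt0n.
  have [kz|kp] := posnP k.
    by rewrite kz addr0; clear - psia; lra.
  have : 1 <= k%:R :> R by rewrite (ler_nat R 1).
  by clear - psik; lra.
have psir : 2 * psi <= r%:R * psi by apply: ler_wpM2r.
(* Up to this threshold, (i) with [7 * r * psi] in place of [phi] gives exactly the error term of
   (ii), and [4 * d / n <= x] lets [near_turan_gain] supply [kap]. *)
have [dpsi|dpsi] := leP d (7 * r%:R * psi).
  have h1 : 2 * (alpha1 + alpha2) <= 7 * r%:R * psi.
    by clear - psia psir psi0; lra.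
  have h2 : 7 * r%:R * psi <= n%:R / 100 by clear - rpsi nR; lra.
  have := close _ dpsi h1 h2; rewrite -/t -/err ler_norml => /andP[_ G_le].
  suff : kap <= mu - l by clear - G_le; lra.
  have [kz|kp] := posnP k.
    apply: le_trans kaple _; rewrite kz expr0n mulr0 mul0r.
    by clear - lmu; lra.
  have k1 : 1 <= k%:R :> R by rewrite (ler_nat R 1).
  have dx : 4 * d / n%:R <= x.
    by rewrite /x ler_pM2r ?invr_gt0 //; clear - dpsi; lra.
  apply: le_trans (near_turan_gain n3 r2 k1 kd dn dx x1 q0 rq l0 ql1 lM lMn) _.
  apply: gain => //; first by rewrite mulr_ge0 // sqr_ge0.
  apply: spread_gain; rewrite -(ler_nat R) natrD natrM.
  by clear - kd; rewrite /n1 /nr in kd; lra.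
(* Beyond the threshold, (i) is used with [phi = d]. The gain [d ^ 2 / (10 n)] covers [kap] and the
   error term, each at most [d ^ 2 / (100 n)], because [k <= d / 42] and
   [56 * (alpha1 + alpha2) <= 2 * d]. *)
have dpsi14 : 14 * psi <= d by clear - dpsi psir; lra.
have d2 : 2 <= d by clear - dpsi14 psi2; lra.
have aphi : 2 * (alpha1 + alpha2) <= d by clear - dpsi14 psia psi0; lra.
have := close d (lexx _) aphi dn; rewrite -/t ler_norml => /andP[_ G_le].
have v0 : 0 <= d ^+ 2 / n%:R by rewrite divr_ge0 ?sqr_ge0 ?ler0n.
have gap : d ^+ 2 / n%:R * (1 / 10) <= mu - l.
  apply: le_trans (gain _ l0 (wsq0 d2) wsq).
  apply: le_trans
    (far_turan_gain (c := 2 / 5) (b := 101 / 100) n3 d2 l0 q0 lM _ _ _ _).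
  - by rewrite -[leRHS]mulrA mulrC; apply: ler_wpM2r => //; clear; lra.
  - by clear - lMn dn; lra.
  - by clear; lra.
  - by clear - ql1 q2 dn n3; lra.
  - by clear; lra.
have kapv : kap <= d ^+ 2 / n%:R * (1 / 100).
  apply: le_trans kaple _; rewrite [leRHS]mulrAC ler_pM2r ?invr_gt0 //.
  have : k%:R ^+ 2 <= (d / 42) ^+ 2.
    by rewrite lerXn2r ?nnegrE; clear - psik dpsi14 d2 k0; lra.
  by clear; have := sqr_ge0 d; lra.
have errv : 56 * (alpha1 + alpha2) * d / n%:R ^+ 2 <= d ^+ 2 / n%:R * (1 / 100).
  have -> : d ^+ 2 / n%:R * (1 / 100) = d * (n%:R / 100) * d / n%:R ^+ 2.
    by field; rewrite gt_eqF.
  rewrite ler_pM2r ?invr_gt0 ?exprn_gt0 //; apply: ler_wpM2r.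
    by clear - d2; lra.
  have : d * 2 <= d * (n%:R / 100).
    by apply: ler_wpM2l; clear - d2 n3; lra.
  by clear - psia dpsi14; lra.
by clear - G_le gap kapv errv v0 err0; lra.
Qed.
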